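(* Let $f\colon\mathbb{R}^n\to\mathbb{R}^+$ be a positive-valued, twice continuously differentiable convex function, and let $$K=\{(t,0)\in\mathbb{R}^{n+1}\mid t\in\mathbb{R}^n\},\qquad L=\{(t,f(t))\in\mathbb{R}^{n+1}\mid t\in\mathbb{R}^n\}.$$ The equidistant points can be written in parametric form as follows: the equidistant set $\{p\in\mathbb{R}^{n+1}\mid d(p,K)=d(p,L)\}$ is equal to $\{(x(t),y(t))\mid t\in\mathbb{R}^n\}$, where $$x(t)=t+\frac{f(t)}{1+\sqrt{1+|\nabla f(t)|^2}}\,\nabla f(t)\qquad\text{and}\qquad y(t)=\frac{f(t)\sqrt{1+|\nabla f(t)|^2}}{1+\sqrt{1+|\nabla f(t)|^2}}\qquad(t\in\mathbb{R}^n).$$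
   Context: $\mathbb{R}^{n+1}$ carries the Euclidean distance $d$, and $d(p,S)=\inf\{d(p,q)\mid q\in S\}$ for a point $p$ and a set $S$. $\nabla f$ denotes the gradient of $f$ and $\mathbb{R}^+$ the set of positive real numbers. *)

(* Defs.v *)
From HB Require Import structures.
From mathcomp Require Import all_boot all_order all_algebra.
From mathcomp Require Import all_classical all_reals all_analysis.

Set Implicit Arguments.
Unset Strict Implicit.
Unset Printing Implicit Defensive.

Import Order.TTheory GRing.Theory Num.Theory.
Import numFieldNormedType.Exports.

Local Open Scope classical_set_scope.
Local Open Scope ring_scope.

(* Points of R^n are row vectors 'rV[R]_n. The library's norm `|v| on them is
   the max norm: it is used below only for its topology (differentiability,
   continuity), which is the Euclidean one; lengths and distances use
   [enorm] and [edistance]. *)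

Definition enorm (R : realType) (n : nat) (v : 'rV[R]_n) : R :=
  Num.sqrt (\sum_(i < n) v 0 i ^+ 2).

Definition edistance (R : realType) (n : nat) (p q : 'rV[R]_n) : R :=
  enorm (p - q).

(* [inf] returns 0 on sets that are empty or not bounded below; the set of
   distances is bounded below by 0, so this is only relevant for S = set0. *)
Definition dist_to (R : realType) (n : nat) (p : 'rV[R]_n)
    (S : set 'rV[R]_n) : R :=
  inf [set edistance p q | q in S].

Definition equidistant (R : realType) (n : nat) (K L : set 'rV[R]_n) :
    set 'rV[R]_n :=
  [set p | dist_to p K = dist_to p L].

Definition gradient (R : realType) (n : nat) (f : 'rV[R]_n -> R)
    (t : 'rV[R]_n) : 'rV[R]_n :=
  \row_(i < n) 'D_(delta_mx 0 i) f t.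

(* f and its gradient are (Frechet) differentiable everywhere, and the second
   derivative, i.e. the Hessian matrix 'J (gradient f), is continuous. *)
Definition twice_cont_diff (R : realType) (n : nat) (f : 'rV[R]_n -> R) :
    Prop :=
  [/\ forall t, differentiable f t,
      forall t, differentiable (gradient f) t &
      continuous (fun t => 'J (gradient f) t)].

(* The point (t, y) of R^(n+1). *)
Definition pair_point (R : realType) (n : nat) (t : 'rV[R]_n) (y : R) :
    'rV[R]_(n + 1) :=
  row_mx t y%:M.

(* Main.v *)
(* The distance from (x, y) to K is |y|. A closest point (t, f t) of L exists by
   coercivity, and the first-order condition puts (x, y) on the normal line at
   t: (x, y) = (t, f t) + c (grad f t, -1) with c = f t - y, at distance |c| s
   from L, where s = sqrt (1 + |grad f t|^2). An equidistant point lies strictly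
   between K and L, so |y| = |c| s reads f t - c = c s, that is
   c = f t / (1 + s). Conversely, convexity puts L above its tangent hyperplane
   at t, so that (t, f t) is the closest point of L to (x t, y t). *)
Require Import Defs.
From HB Require Import structures.
From mathcomp Require Import all_boot all_order all_algebra.
From mathcomp Require Import all_classical all_reals all_analysis.
From mathcomp Require Import ring lra.

Set Implicit Arguments.
Unset Strict Implicit.
Unset Printing Implicit Defensive.

Import Order.TTheory GRing.Theory Num.Theory.
Import numFieldNormedType.Exports.

Local Open Scope classical_set_scope.
Local Open Scope ring_scope.

(** * Euclidean inner product *)

Definition dotp (R : realType) (n : nat) (u v : 'rV[R]_n) : R :=
  \sum_(i < n) u 0 i * v 0 i.

Lemma dotpC (R : realType) (n : nat) (u v : 'rV[R]_n) : dotp u v = dotp v u.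
Proof. by apply: eq_bigr => i _; rewrite mulrC. Qed.

Lemma dotpDl (R : realType) (n : nat) (u v w : 'rV[R]_n) :
  dotp (u + v) w = dotp u w + dotp v w.
Proof. by rewrite -big_split; apply: eq_bigr => i _; rewrite mxE mulrDl. Qed.

Lemma dotpZl (R : realType) (n : nat) (a : R) (u v : 'rV[R]_n) :
  dotp (a *: u) v = a * dotp u v.
Proof. by rewrite /dotp mulr_sumr; apply: eq_bigr => i _; rewrite mxE mulrA. Qed.

Lemma dotpBl (R : realType) (n : nat) (u v w : 'rV[R]_n) :
  dotp (u - v) w = dotp u w - dotp v w.
Proof. by rewrite dotpDl -scaleN1r dotpZl mulN1r. Qed.

Lemma dotpBr (R : realType) (n : nat) (u v w : 'rV[R]_n) :
  dotp u (v - w) = dotp u v - dotp u w.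
Proof. by rewrite dotpC dotpBl !(dotpC u). Qed.

Lemma dotpZr (R : realType) (n : nat) (a : R) (u v : 'rV[R]_n) :
  dotp u (a *: v) = a * dotp u v.
Proof. by rewrite dotpC dotpZl dotpC. Qed.

Lemma dotp_subZ (R : realType) (n : nat) (a : R) (u v : 'rV[R]_n) :
  dotp (u - a *: v) (u - a *: v) =
  dotp u u - 2 * a * dotp u v + a ^+ 2 * dotp v v.
Proof.
by rewrite dotpBl !dotpBr (dotpC (a *: v) u) !dotpZr dotpZl; ring.
Qed.

Lemma dotp0 (R : realType) (n : nat) (u : 'rV[R]_n) : dotp u 0 = 0.
Proof. by rewrite -(scale0r 0) dotpZr mul0r. Qed.

Lemma dotp_ge0 (R : realType) (n : nat) (u : 'rV[R]_n) : 0 <= dotp u u.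
Proof. by apply: sumr_ge0 => i _; rewrite -expr2 sqr_ge0. Qed.

Lemma sqr_coord_le_dotp (R : realType) (n : nat) (u : 'rV[R]_n) (i : 'I_n) :
  u 0 i ^+ 2 <= dotp u u.
Proof.
rewrite /dotp (bigD1 i)//= -expr2 lerDl.
by apply: sumr_ge0 => j _; rewrite -expr2 sqr_ge0.
Qed.

Lemma sqr_enorm (R : realType) (n : nat) (u : 'rV[R]_n) :
  enorm u ^+ 2 = dotp u u.
Proof.
rewrite /enorm sqr_sqrtr; last by apply: sumr_ge0 => i _; exact: sqr_ge0.
by apply: eq_bigr => i _; rewrite expr2.
Qed.

(** * Distances from a point to a hyperplane and to a graph *)

Lemma edistance_pair_point (R : realType) (n : nat) (x t : 'rV[R]_n) (y z : R) :
  edistance (pair_point x y) (pair_point t z) =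
  Num.sqrt (dotp (x - t) (x - t) + (y - z) ^+ 2).
Proof.
rewrite /edistance /enorm big_split_ord/= big_ord1; congr Num.sqrt.
congr (_ + _); last by rewrite /pair_point opp_row_mx add_row_mx row_mxEr !mxE eqxx.
apply: eq_bigr => i _.
by rewrite /pair_point opp_row_mx add_row_mx row_mxEl expr2.
Qed.

Lemma pair_pointP (R : realType) (n : nat) (p : 'rV[R]_(n + 1)) :
  exists x y, p = pair_point x y.
Proof.
by exists (lsubmx p), (rsubmx p 0 0); rewrite /pair_point -mx11_scalar hsubmxK.
Qed.

Lemma dist_to_attained (R : realType) (n : nat) (p q : 'rV[R]_n)
    (S : set 'rV[R]_n) :
  S q -> (forall r, S r -> edistance p q <= edistance p r) ->
  dist_to p S = edistance p q.
Proof.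
move=> Sq minq; apply/eqP; rewrite eq_le; apply/andP; split.
  apply: ge_inf; last by exists q.
  by exists 0 => _ [r _ <-]; exact: sqrtr_ge0.
apply: lb_le_inf; first by exists (edistance p q), q.
by move=> _ [r Sr <-]; exact: minq.
Qed.

(** The squared distance from [(x, y)] to the graph point over [t]. Without the square root it is
    differentiable in [t] wherever [f] is, even at distance 0. *)
Definition sqr_dist_graph (R : realType) (n : nat) (f : 'rV[R]_n -> R)
    (x : 'rV[R]_n) (y : R) (t : 'rV[R]_n) : R :=
  dotp (x - t) (x - t) + (y - f t) ^+ 2.

Lemma dist_to_graph (R : realType) (n : nat) (f : 'rV[R]_n -> R)
    (x t : 'rV[R]_n) (y : R) :
  (forall u, sqr_dist_graph f x y t <= sqr_dist_graph f x y u) ->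
  dist_to (pair_point x y) [set pair_point u (f u) | u in [set: 'rV[R]_n]] =
  Num.sqrt (sqr_dist_graph f x y t).
Proof.
move=> tmin; rewrite -edistance_pair_point; apply: dist_to_attained.
  by exists t.
by move=> _ [u _ <-]; rewrite !edistance_pair_point; exact/ler_wsqrtr/tmin.
Qed.

Lemma dist_to_hyperplane (R : realType) (n : nat) (x : 'rV[R]_n) (y : R) :
  dist_to (pair_point x y) [set pair_point u 0 | u in [set: 'rV[R]_n]] = `|y|.
Proof.
(* The hyperplane is the graph of the zero function, and the minimizing parameter is [x] itself. *)
rewrite (@dist_to_graph _ _ (fun=> 0) x x) => [|u]; rewrite /sqr_dist_graph subrr dotp0.
  by rewrite add0r subr0 sqrtr_sqr.
by rewrite add0r lerDr dotp_ge0.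
Qed.

(** * Existence of a closest graph point *)

Lemma continuous_sqr_dist_graph (R : realType) (n : nat) (f : 'rV[R]_n -> R)
    (x : 'rV[R]_n) (y : R) :
  continuous f -> continuous (sqr_dist_graph f x y).
Proof.
move=> cf t.
have cx (i : 'I_n) : (fun u : 'rV[R]_n => (x - u) 0 i) @ t --> (x - t) 0 i.
  rewrite (_ : (fun u => _) = (fun u : 'rV[R]_n => x 0 i - u 0 i)); last first.
    by apply/funext => u; rewrite !mxE.
  by rewrite !mxE; exact: (cvgB (cvg_cst _) (@coord_continuous _ _ _ 0 i t)).
have cy : (fun u => y - f u) @ t --> y - f t.
  exact: (cvgB (cvg_cst _) (cf t)).
have cdot : (fun u => dotp (x - u) (x - u)) @ t --> dotp (x - t) (x - t).
  apply: cvg_big => [||i _]; [exact: add_continuous|exact: nbhs_filter|].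
  exact: cvgM (cx i) (cx i).
exact: cvgD cdot (cvgM cy cy).
Qed.

(** Outside a large enough box around [x], a single coordinate of [x - u] already makes the squared
    distance at least [F x], so the minimum over the compact box is global. *)
Lemma closest_graph_point (R : realType) (n : nat) (f : 'rV[R]_n -> R)
    (x : 'rV[R]_n) (y : R) : continuous f ->
  exists t, forall u, sqr_dist_graph f x y t <= sqr_dist_graph f x y u.
Proof.
move=> cf; set F := sqr_dist_graph f x y.
have Fx0 : 0 <= F x by rewrite addr_ge0 ?dotp_ge0 ?sqr_ge0.
(* The summand 1 ensures [F x <= r ^+ 2] also when [F x < 1]. *)
pose r := 1 + F x.
pose box (i : 'I_n) := `[x ord0 i - r, x ord0 i + r]%classic.
have Ax i : box i (x ord0 i) by rewrite /box/= in_itv/= /r; lra.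
have [||t _ tmin] := @EVT_min_rV _ _ F [set v | forall i, box i (v ord0 i)]
    (ex_intro _ x Ax).
- by apply: rV_compact => i; exact: segment_compact.
- exact/continuous_subspaceT/continuous_sqr_dist_graph.
exists t => u.
have [Au|] := pselect (forall i, box i (u ord0 i)); first by apply: tmin; rewrite inE.
move=> /existsNP[i ui].
apply: (@le_trans _ _ (F x)); first by apply: tmin; rewrite inE.
have: F x <= (x - u) 0 i ^+ 2.
  move: ui; rewrite /box/= in_itv/= !mxE /r => /negP; rewrite negb_and -!ltNge.
  by move=> /orP[] ?; nra.
move=> /le_trans; apply; apply: le_trans (sqr_coord_le_dotp _ i) _.
by rewrite lerDl sqr_ge0.
Qed.

(** * Gradient, normal lines and the tangent inequality *)

Lemma derive_gradient (R : realType) (n : nat) (f : 'rV[R]_n -> R)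
    (t v : 'rV[R]_n) :
  differentiable f t -> 'D_v f t = dotp (gradient f t) v.
Proof.
move=> df; rewrite deriveE// {1}[v]row_sum_delta linear_sum/=.
by apply: eq_bigr => i _; rewrite linearZ/= !mxE deriveE// mulrC.
Qed.

Lemma is_derive_line (R : realType) (n : nat) (f : 'rV[R]_n -> R)
    (t v : 'rV[R]_n) (h : R) : (forall u, differentiable f u) ->
  is_derive h 1 (fun k : R => f (t + k *: v)) (dotp (gradient f (t + h *: v)) v).
Proof.
move=> df; rewrite -derive_gradient//.
(* The difference quotient at [h] of the restriction to the line is that of [f] at [t + h *: v] in
   direction [v]. *)
have Eh : (fun k : R => k^-1 *: (f (t + (k%:A + h) *: v) - f (t + h *: v))) =
         (fun k : R => k^-1 *: (f (k *: v + (t + h *: v)) - f (t + h *: v))).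
  by apply/funext => k; rewrite [k%:A]mulr1 scalerDl addrCA.
have dv : derivable f (t + h *: v) v by exact: diff_derivable.
by apply: DeriveDef; rewrite ?/derivable /derive/= Eh.
Qed.

(** Along each coordinate line through [t] the squared distance is a function [G] of one variable
    with a minimum at 0; the vanishing of its derivative there is one coordinate of the identity. *)
Lemma closest_graph_point_normal (R : realType) (n : nat) (f : 'rV[R]_n -> R)
    (x t : 'rV[R]_n) (y : R) : (forall u, differentiable f u) ->
  (forall u, sqr_dist_graph f x y t <= sqr_dist_graph f x y u) ->
  x = t + (f t - y) *: gradient f t.
Proof.
move=> df tmin; apply/rowP => i.
pose v : 'rV[R]_n := delta_mx 0 i.
have vi : v 0 i = 1 by rewrite mxE !eqxx.
pose q (k : R) := f (t + k *: v).
have dotv w : dotp w v = w 0 i.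
  rewrite /dotp (bigD1 i)//= big1 => [|j ji]; first by rewrite !mxE !eqxx mulr1 addr0.
  by rewrite !mxE (negbTE ji) andbF mulr0.
set w := x - t.
pose G (k : R) := dotp w w - 2 * k * w 0 i + k ^+ 2 + (y - q k) ^+ 2.
have FG k : sqr_dist_graph f x y (t + k *: v) = G k.
  rewrite /sqr_dist_graph /G opprD addrA -/w; congr (_ + _).
  by rewrite dotp_subZ !dotv vi; ring.
have dG (h : R) : is_derive h 1 G
    (- 2 * w 0 i + 2 * h + 2 * (y - q h) * (- dotp (gradient f (t + h *: v)) v)).
  have dq := is_derive_line t v h df.
  rewrite /G; apply: is_derive_eq.
  by rewrite /GRing.scale/= /q; ring.
(* The minimum is global, so any open interval around 0 would do. *)
have [|h _||h _|_ G0] := @derive1_at_min _ G (-1) 1 0.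
- by lra.
- by [].
- by rewrite in_itv/=; lra.
- by rewrite -!FG scale0r addr0.
have := @derive_val _ _ _ _ _ _ _ (dG 0).
rewrite G0 scale0r addr0 dotv /q scale0r addr0 /w.
by move: (gradient f t) => g; rewrite !mxE; lra.
Qed.

(** For [0 < h <= 1], convexity bounds the difference quotient of [f] at [t] in direction [u - t]
    with step [h] by [f u - f t]; the bound survives the limit as [h] tends to 0 from the right. *)
Lemma convex_ge_tangent (R : realType) (n : nat) (f : 'rV[R]_n -> R)
    (t u : 'rV[R]_n) : differentiable f t ->
  convex_function [set: convex_lmodType 'rV[R]_n] f ->
  f t + dotp (gradient f t) (u - t) <= f u.
Proof.
move=> df cvx; rewrite -derive_gradient// -lerBrDl.
have /cvg_dnbhs_at_right qD := diff_derivable (v := u - t) df.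
apply: (cvgr_to_le qD); near=> h.
have h0 : 0 < h by [].
have h1 : h <= 1 by near: h; exact: nbhs_right_le.
pose k : {i01 R} := Itv01 (ltW h0) h1.
have := cvx k (u : convex_lmodType 'rV[R]_n) t (mem_set I) (mem_set I).
rewrite (_ : conv k (u : convex_lmodType 'rV[R]_n) t = h *: (u - t) + t); last first.
  by rewrite /conv/= scalerBr scalerBl scale1r addrAC addrA.
rewrite convRE/= => cvxh.
rewrite /GRing.scale/= mulrC ler_pdivrMr//.
by move: cvxh; rewrite /unstable.onem /=; lra.
Unshelve. all: by end_near. Qed.

(* If the closest graph point (t, f t) were below the height y, the graph would
   cross the segment from (t, y) to (x, y), and the crossing is closer. *)
Lemma closest_graph_point_below (R : realType) (n : nat) (f : 'rV[R]_n -> R)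
    (x t : 'rV[R]_n) (y : R) : continuous f ->
  (forall u, sqr_dist_graph f x y t <= sqr_dist_graph f x y u) ->
  y < f x -> y <= f t.
Proof.
move=> cf tmin yfx; rewrite leNgt; apply/negP => fty.
pose q (k : R) := f (t + k *: (x - t)).
have cq : continuous q.
  move=> k; have lk : (fun k => t + k *: (x - t)) @ k --> t + k *: (x - t).
    exact: (cvgD (cvg_cst _) (@scalel_continuous _ _ _ k)).
  exact: cvg_comp lk (cf _).
have q0 : q 0 = f t by rewrite /q scale0r addr0.
have q1 : q 1 = f x by rewrite /q scale1r addrC subrK.
have [|k] := @IVT _ q 0 1 y ler01 (continuous_subspaceT cq).
  by rewrite q0 q1 ge_min le_max (ltW fty) (ltW yfx) orbT.
rewrite in_itv/= => /andP[k0 k1] qk.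
have := tmin (t + k *: (x - t)).
rewrite /sqr_dist_graph -/(q k) qk subrr.
have -> : x - (t + k *: (x - t)) = (1 - k) *: (x - t).
  by rewrite scalerBl scale1r opprD addrA.
have d_ge0 := dotp_ge0 (x - t); rewrite dotpZl dotpZr.
(* The factor is [1 - (1 - k) ^+ 2]: the crossing is horizontally no farther from [x] than [t] is,
   and its vertical gap is 0 instead of [y - f t > 0]. *)
have : 0 <= k * (2 - k) * dotp (x - t) (x - t).
  by rewrite !mulr_ge0//; lra.
by nra.
Qed.

(* Only the tangent inequality at t is needed: the point (t, f t) + c (g, -1)
   of the normal ray projects to (t, f t) on the half-space above the tangent
   hyperplane, which contains (u, f u). *)
Lemma normal_footpoint (R : realType) (n : nat) (f : 'rV[R]_n -> R)
    (t u : 'rV[R]_n) (c : R) :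
  0 <= c -> f t + dotp (gradient f t) (u - t) <= f u ->
  sqr_dist_graph f (t + c *: gradient f t) (f t - c) t <=
  sqr_dist_graph f (t + c *: gradient f t) (f t - c) u.
Proof.
move: (gradient f t) => g c0 tangent.
rewrite /sqr_dist_graph addrAC subrr add0r.
have -> : t + c *: g - u = c *: g - 1 *: (u - t).
  by rewrite scale1r opprB addrCA addrA.
move: (u - t) tangent => w tangent; rewrite dotp_subZ !dotpZl !dotpZr -subr_ge0.
have -> : c * (c * dotp g g) - 2 * 1 * (c * dotp g w) + 1 ^+ 2 * dotp w w +
    (f t - c - f u) ^+ 2 - (c * (c * dotp g g) + (f t - c - f t) ^+ 2) =
    dotp w w + (f u - f t) ^+ 2 + 2 * c * (f u - (f t + dotp g w)) by ring.
by rewrite !addr_ge0 ?dotp_ge0 ?sqr_ge0// !mulr_ge0// subr_ge0.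
Qed.

Theorem theorem2 (R : realType) (n : nat) (f : 'rV[R]_n -> R)
    (f_gt0 : forall t, 0 < f t)
    (f_C2 : twice_cont_diff f)
    (f_convex : convex_function [set: convex_lmodType 'rV[R]_n] f) :
  let K : set 'rV[R]_(n + 1) := [set pair_point t 0 | t in [set: 'rV[R]_n]] in
  let L : set 'rV[R]_(n + 1) := [set pair_point t (f t) | t in [set: 'rV[R]_n]] in
  let s (t : 'rV[R]_n) : R := Num.sqrt (1 + enorm (gradient f t) ^+ 2) in
  let x (t : 'rV[R]_n) : 'rV[R]_n := t + (f t / (1 + s t)) *: gradient f t in
  let y (t : 'rV[R]_n) : R := f t * s t / (1 + s t) in
  equidistant K L = [set pair_point (x t) (y t) | t in [set: 'rV[R]_n]].
Proof.
move=> K L s x y; case: f_C2 => df _ _.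
have cf : continuous f by move=> t; exact: differentiable_continuous.
have s2 t : s t ^+ 2 = 1 + dotp (gradient f t) (gradient f t).
  by rewrite sqr_sqrtr sqr_enorm// addr_ge0// dotp_ge0.
have s_gt0 t : 0 < s t by rewrite sqrtr_gt0 sqr_enorm ltr_wpDr// dotp_ge0.
have yE t : y t = f t - f t / (1 + s t).
  by rewrite /y; field; rewrite gt_eqF// ltr_pwDl// ltW.
have normal_sqr_dist t c : sqr_dist_graph f (t + c *: gradient f t) (f t - c) t =
    (c * s t) ^+ 2.
  rewrite /sqr_dist_graph addrAC subrr add0r dotpZl dotpZr exprMn s2.
  by ring.
apply/seteqP; split => [p|_ [t _ <-]]; rewrite /equidistant/=; last first.
  (* The parametrized point lies on the normal line at offset [c = f t / (1 + s t)]. Its foot is the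
     closest graph point, at distance [c * s t], which is the height [y t]. *)
  have c_ge0 : 0 <= f t / (1 + s t) by rewrite ltW// divr_gt0// addr_gt0.
  rewrite dist_to_hyperplane [in RHS]yE (dist_to_graph (t := t)) => [|u].
    rewrite normal_sqr_dist sqrtr_sqr /y.
    by congr `|_|; ring.
  exact/normal_footpoint/convex_ge_tangent.
have [a [b ->]] := pair_pointP p; rewrite dist_to_hyperplane.
have [t tmin] := closest_graph_point a b cf.
rewrite (dist_to_graph tmin) => bE.
have aE := closest_graph_point_normal df tmin.
have b2 : b ^+ 2 = ((f t - b) * s t) ^+ 2.
  rewrite -normal_sqr_dist -aE opprB addrCA subrr addr0.
  rewrite -[LHS]real_normK ?num_real// bE sqr_sqrtr//.
  by rewrite addr_ge0 ?dotp_ge0 ?sqr_ge0.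
have s_ge1 : 1 <= s t.
  by rewrite -(expr_ge1 (ltn0Sn 1)) ?(ltW (s_gt0 t))// s2 lerDl dotp_ge0.
(* Below the hyperplane, the distance to the graph is at least [f t - b], which exceeds [- b]. *)
have b_ge0 : 0 <= b.
  rewrite leNgt; apply/negP => b_lt0; have ft0 := f_gt0 t.
  have : - b < (f t - b) * s t.
    by apply: (@lt_le_trans _ _ (f t - b)); [lra|rewrite ler_peMr//; lra].
  by move: b2 b_lt0; move: ((f t - b) * s t) => z b2 b_lt0 zb; nra.
(* If [f a <= b], the graph point over [a] is at distance [b - f a < b], closer than the closest
   one. *)
have b_lt_fa : b < f a.
  rewrite ltNge; apply/negP => fab; have := tmin a.
  have -> : sqr_dist_graph f a b t = b ^+ 2.
    by rewrite aE -[X in sqr_dist_graph f _ X](subKr (f t)) normal_sqr_dist.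
  rewrite /sqr_dist_graph subrr dotp0 add0r; have := f_gt0 a; nra.
have b_le_ft := closest_graph_point_below cf tmin b_lt_fa.
have bs : b = (f t - b) * s t.
  by apply/eqP; rewrite -(eqrXn2 (n := 2))// ?b2// mulr_ge0 ?subr_ge0// ltW.
(* With [c = f t - b], [bs] gives [c * (1 + s t) = c + b = f t]. *)
have cE : f t - b = f t / (1 + s t).
  by apply: (canRL (mulfK _)); [rewrite gt_eqF// addr_gt0|by rewrite mulrDr mulr1 -bs subrK].
exists t => //; congr pair_point.
  by rewrite /x -cE -aE.
by rewrite yE -cE subKr.
Qed.
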